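(* Let $k$ be a field with separable closure $k^s$, $G$ a reductive group over $k$ with a finite-dimensional representation $\rho:G\to\mathrm{GL}(V)$ over $k$, and $f \in (V/\!\!/G)(k)$ a rational invariant such that $G(k^s)$ acts transitively on $V_f(k^s)$ with abelian stabilizers. Then $d_f = 0$ in $H^2(k,G_f)$ if and only if there exists a pure inner form $G^c$ of $G$ (with $c$ a $1$-cocycle with values in $G(k^s)$) such that $V_f^c(k)$ is nonempty. In particular, when $H^1(k,G) = 1$, the condition $d_f = 0$ is necessary and sufficient for $V_f(k)$ to be nonempty (i.e. for the existence of $G(k)$-orbits on $V_f(k)$).
   Context: $V/\!\!/G=\mathrm{Spec}(\mathrm{Sym}^*(V^\vee)^G)$, $V_f$ the fiber over $f$ of $V\to V/\!\!/G$. $G_f$: for $v\in V_f(k^s)$, $\sigma\in\mathrm{Gal}(k^s/k)$ choose $g_\sigma\in G(k^s)$ with $g_\sigma\,{}^\sigma v=v$; conjugation by $g_\sigma$ gives well-defined isomorphisms ${}^\sigma(G_v)\to G_v$ (stabilizers being abelian), which are descent data; $G_f$ is the resulting commutative $k$-group scheme with isomorphisms $\iota_v:G_f(k^s)\to G_v$ satisfying $\iota_{hv}(b)=h\iota_v(b)h^{-1}$ and ${}^\sigma(\iota_v(b))=\iota_{{}^\sigma v}({}^\sigma b)$. $d_f\in H^2(k,G_f)$ is the class of the $2$-cocycle $d_{\sigma,\tau}=\iota_v^{-1}(g_\sigma\,{}^\sigma g_\tau\,g_{\sigma\tau}^{-1})$ (independent of choices). Pure inner form: for a $1$-cocycle $c$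 with values in $G(k^s)$, $G^c(k^s)=G(k^s)$ with Galois action $\sigma*h=c_\sigma\,{}^\sigma h\,c_\sigma^{-1}$; choosing $g\in\mathrm{GL}(V)(k^s)$ with $\rho(c_\sigma)=g^{-1}\,{}^\sigma g$, $G^c$ acts on $V$ over $k$ via $h\mapsto g\rho(h)g^{-1}$, and $V_f^c(k):=V(k)\cap gV_f(k^s)$. *)

(* Defs.v *)
From HB Require Import structures.
From mathcomp Require Import all_boot all_order all_algebra all_field.
From mathcomp Require Import mpoly.
From mathcomp Require Import boolp.

Set Implicit Arguments.
Unset Strict Implicit.
Unset Printing Implicit Defensive.

Import GRing.Theory.
Local Open Scope ring_scope.
Local Obligation Tactic := idtac.

(* A commutative algebra over k is a ring morphism out of k; this makes an
   infinite field extension of k a k-algebra without further structure. *)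
Record kAlg (k : fieldType) := KAlg {
  kalg_ring :> comNzRingType;
  kalg_map : {rmorphism k -> kalg_ring} }.

Record kHom (k : fieldType) (A B : kAlg k) := KHom {
  khom_map :> {rmorphism A -> B};
  khom_comm : forall x : k, khom_map (kalg_map A x) = kalg_map B x }.

Lemma kHom_ext (k : fieldType) (A B : kAlg k) (u v : kHom A B) :
  u =1 v -> u = v.
Proof.
case: u v => [u cu] [v cv] /= uv.
have e : u = v.
  move: u v {cu cv} uv => [u [[a] [b]]] [v [[c] [d]]] /= /funext e.
  move: e a b c d => <- a b c d.
  by rewrite (Prop_irrelevance a c) (Prop_irrelevance b d).
by move: e cu cv {uv} => -> cu cv; rewrite (Prop_irrelevance cu cv).
Qed.

Definition kHom_id (k : fieldType) (A : kAlg k) : kHom A A :=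
  @KHom k A A (idfun : {rmorphism A -> A}) (fun=> erefl).

Program Definition kHom_comp (k : fieldType) (A B C : kAlg k)
    (v : kHom B C) (u : kHom A B) : kHom A C :=
  @KHom k A C (v \o u : {rmorphism A -> C}) _.
Next Obligation. by move=> k A B C v u x /=; rewrite !khom_comm. Qed.

Definition kAlg_base (k : fieldType) : kAlg k :=
  @KAlg k k (idfun : {rmorphism k -> k}).

Definition kAlg_restr (k K : fieldType) (j : {rmorphism k -> K}) (S : kAlg K) :
  kAlg k := @KAlg k S (kalg_map S \o j : {rmorphism k -> S}).

Program Definition kHom_restr (k K : fieldType) (j : {rmorphism k -> K})
    (S T : kAlg K) (u : kHom S T) : kHom (kAlg_restr j S) (kAlg_restr j T) :=
  @KHom k (kAlg_restr j S) (kAlg_restr j T) (khom_map u) _.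
Next Obligation. by move=> k K j S T u x /=; rewrite khom_comm. Qed.

Record groupFunctor (k : fieldType) := GroupFunctor {
  pts :> kAlg k -> Type;
  pmap : forall S T : kAlg k, kHom S T -> pts S -> pts T;
  pone : forall S, pts S;
  pmul : forall S, pts S -> pts S -> pts S;
  pinv : forall S, pts S -> pts S;
  pmap_id : forall S (x : pts S), pmap (kHom_id S) x = x;
  pmap_comp : forall S T U (v : kHom T U) (u : kHom S T) (x : pts S),
    pmap (kHom_comp v u) x = pmap v (pmap u x);
  pmap_mul : forall S T (u : kHom S T) (x y : pts S),
    pmap u (pmul x y) = pmul (pmap u x) (pmap u y);
  pmulA : forall S, associative (@pmul S);
  pmul1 : forall S, left_id (pone S) (@pmul S);
  pmulV : forall S, left_inverse (pone S) (@pinv S) (@pmul S) }.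

Arguments pmap {k} g {S T} _ _.
Arguments pone {k} g S.
Arguments pmul {k g S}.
Arguments pinv {k g S}.

(* By Yoneda, u is the universal point, i.e. the identity of Spec O. *)
Definition represents (k : fieldType) (G : groupFunctor k) (O : kAlg k)
    (u : G O) : Prop :=
  forall (S : kAlg k) (x : G S), exists! phi : kHom O S, pmap G phi u = x.

Definition affine_group (k : fieldType) (G : groupFunctor k) : Prop :=
  exists (O : kAlg k) (u : G O), represents u.

Definition finitely_generated (k : fieldType) (O : kAlg k) : Prop :=
  exists (m : nat) (s : 'I_m -> O),
    forall a : O, exists p : {mpoly k[m]}, a = mmap (kalg_map O) s p.

Definition algebraic_group (k : fieldType) (G : groupFunctor k) : Prop :=
  exists (O : kAlg k) (u : G O), represents u /\ finitely_generated O.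

Definition commutative_group (k : fieldType) (G : groupFunctor k) : Prop :=
  forall S : kAlg k, commutative (@pmul k G S).

(* The infinitesimal lifting criterion; smoothness for G of finite type. *)
Definition formally_smooth (k : fieldType) (G : groupFunctor k) : Prop :=
  forall (S T : kAlg k) (q : kHom S T),
    (forall t : T, exists s : S, q s = t) ->
    (forall a b : S, q a = 0 -> q b = 0 -> a * b = 0) ->
    forall y : G T, exists x : G S, pmap G q x = y.

Program Definition base_change (k K : fieldType) (j : {rmorphism k -> K})
    (G : groupFunctor k) : groupFunctor K :=
  @GroupFunctor K (fun S => G (kAlg_restr j S))
    (fun S T u => pmap G (kHom_restr j u))
    (fun S => pone G (kAlg_restr j S))
    (fun S => @pmul k G (kAlg_restr j S))
    (fun S => @pinv k G (kAlg_restr j S)) _ _ _ _ _ _.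
Next Obligation.
move=> k K j G S x /=; rewrite -[RHS]pmap_id; congr (pmap G _ x).
exact: kHom_ext.
Qed.
Next Obligation.
move=> k K j G S T U v u x /=; rewrite -pmap_comp; congr (pmap G _ x).
exact: kHom_ext.
Qed.
Next Obligation. by move=> k K j G S T u x y /=; rewrite pmap_mul. Qed.
Next Obligation. by move=> k K j G S /=; exact: pmulA. Qed.
Next Obligation. by move=> k K j G S /=; exact: pmul1. Qed.
Next Obligation. by move=> k K j G S /=; exact: pmulV. Qed.

(* A morphism of group functors G -> GL_n; rep_mx takes invertible values
   since the source is a group. *)
Record representation (k : fieldType) (G : groupFunctor k) (n : nat) := Rep {
  rep_mx :> forall S : kAlg k, G S -> 'M[S]_n;
  rep_nat : forall (S T : kAlg k) (u : kHom S T) (x : G S),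
    rep_mx (pmap G u x) = map_mx u (rep_mx x);
  rep_one : forall S : kAlg k, rep_mx (pone G S) = 1%:M;
  rep_mul : forall (S : kAlg k) (x y : G S),
    rep_mx (pmul x y) = rep_mx x *m rep_mx y }.

Arguments rep_mx {k G n} r {S} _.

(* By Yoneda, the elements of the coordinate ring of an affine G. *)
Record regular_function (k : fieldType) (G : groupFunctor k) := RegFun {
  regf :> forall S : kAlg k, G S -> S;
  regf_nat : forall (S T : kAlg k) (u : kHom S T) (x : G S),
    regf (pmap G u x) = u (regf x) }.

Arguments regf {k G} r {S} _.

Section UnipotentRadical.

Variables (K : fieldType) (G : groupFunctor K).
Let GK := G (kAlg_base K).

Definition zariski_closed (Z : GK -> Prop) : Prop :=
  exists I : regular_function G -> Prop,
    forall x : GK, Z x <-> (forall F, I F -> regf F x = 0).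

Definition zariski_connected (Z : GK -> Prop) : Prop :=
  forall Z1 Z2 : GK -> Prop, zariski_closed Z1 -> zariski_closed Z2 ->
    (forall x, Z x <-> Z1 x \/ Z2 x) ->
    (forall x, ~ (Z1 x /\ Z2 x)) ->
    (forall x, ~ Z1 x) \/ (forall x, ~ Z2 x).

Definition normal_subgroup (N : GK -> Prop) : Prop :=
  [/\ N (pone G _),
      forall x y, N x -> N y -> N (pmul x y),
      forall x, N x -> N (pinv x) &
      forall h x, N x -> N (pmul (pmul h x) (pinv h))].

Definition unipotent (x : GK) : Prop :=
  forall (m : nat) (r : representation G m),
    exists e : nat, iter e (mulmx (rep_mx r x - 1%:M)) 1%:M = 0.

(* For K algebraically closed and G affine of finite type over K, closed
   subsets of G(K) correspond to reduced closed subschemes of G, and reduced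
   subgroup schemes are smooth. *)
Definition trivial_unipotent_radical : Prop :=
  forall N : GK -> Prop,
    zariski_closed N -> zariski_connected N -> normal_subgroup N ->
    (forall x, N x -> unipotent x) ->
    forall x, N x -> x = pone G _.

End UnipotentRadical.

Definition is_algebraic_closure (k K : fieldType) (j : {rmorphism k -> K}) :
  Prop :=
  GRing.closed_field_axiom K /\ (forall x : K, algebraicOver j x).

Definition reductive (k : fieldType) (G : groupFunctor k) : Prop :=
  [/\ algebraic_group G, formally_smooth G &
      forall (K : fieldType) (j : {rmorphism k -> K}),
        is_algebraic_closure j -> trivial_unipotent_radical (base_change j G)].

(* separable_poly p means that p is coprime to its derivative. *)
Definition is_separable_closure (k ks : fieldType) (i : {rmorphism k -> ks}) :
  Prop :=
  (forall x : ks, exists p : {poly k},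
      separable_poly p /\ root (map_poly i p) x) /\
  (forall p : {poly ks}, separable_poly p -> (1 < size p)%N ->
      exists x : ks, root p x).

Section Invariants.

Variables (k : fieldType) (G : groupFunctor k) (n : nat).
Variable rho : representation G n.

Definition evalV (S : kAlg k) (v : 'cV[S]_n) (p : {mpoly k[n]}) : S :=
  mmap (kalg_map S) (fun i => v i 0) p.

(* Sym^*(V^vee) is {mpoly k[n]} for V = k^n; testing invariance on all
   S-valued points tests it on the universal one. *)
Definition invariant (p : {mpoly k[n]}) : Prop :=
  forall (S : kAlg k) (g : G S) (v : 'cV[S]_n),
    evalV (rep_mx rho g *m v) p = evalV v p.

Definition invariant_pred : {pred {mpoly k[n]}} :=
  fun p => `[< invariant p >].

Lemma invariant_subring : subring_closed invariant_pred.
Proof.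
split=> [|p q|p q]; rewrite /invariant_pred !unfold_in.
- by apply/asboolP => S g v; rewrite /evalV !rmorph1.
- move=> /asboolP hp /asboolP hq; apply/asboolP => S g v.
  by move: (hp S g v) (hq S g v); rewrite /evalV !rmorphB /= => -> ->.
- move=> /asboolP hp /asboolP hq; apply/asboolP => S g v.
  by move: (hp S g v) (hq S g v); rewrite /evalV !rmorphM /= => -> ->.
Qed.

HB.instance Definition _ :=
  GRing.isSubringClosed.Build {mpoly k[n]} invariant_pred invariant_subring.

Record invPoly := InvPoly {
  inv_poly :> {mpoly k[n]};
  inv_polyP : inv_poly \in invariant_pred }.

HB.instance Definition _ := [isSub for inv_poly].
HB.instance Definition _ := [Choice of invPoly by <:].
HB.instance Definition _ := [SubChoice_isSubComNzRing of invPoly by <:].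

Lemma invariantC (c : k) : c%:MP \in invariant_pred.
Proof. by rewrite unfold_in; apply/asboolP => S g v; rewrite /evalV !mmapC. Qed.

Definition inv_const (c : k) : invPoly := InvPoly (invariantC c).

Lemma inv_const_zmod : zmod_morphism inv_const.
Proof. by move=> a b; apply: val_inj; rewrite /= mpolyCB. Qed.

Lemma inv_const_monoid : monoid_morphism inv_const.
Proof. by split=> [|a b]; apply: val_inj; rewrite //= mpolyCM. Qed.

HB.instance Definition _ :=
  GRing.isZmodMorphism.Build k invPoly inv_const inv_const_zmod.
HB.instance Definition _ :=
  GRing.isMonoidMorphism.Build k invPoly inv_const inv_const_monoid.

(* The coordinate ring of V // G. *)
Definition inv_ring : kAlg k :=
  @KAlg k invPoly (inv_const : {rmorphism k -> invPoly}).

Definition quotient_point : Type := kHom inv_ring (kAlg_base k).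

Definition fiber (f : quotient_point) (S : kAlg k) (v : 'cV[S]_n) : Prop :=
  forall p : invPoly, evalV v p = kalg_map S (f p).

End Invariants.

Section Galois.

Variables (k ks : fieldType) (i : {rmorphism k -> ks}).

Definition kAlg_sep : kAlg k := @KAlg k ks i.

Record galAut := GalAut {
  gal_hom :> kHom kAlg_sep kAlg_sep;
  gal_bij : bijective gal_hom }.

Definition gal_mul (s t : galAut) : galAut :=
  @GalAut (kHom_comp s t) (bij_comp (gal_bij s) (gal_bij t)).

(* Basic neighbourhoods in the Krull topology. *)
Definition gal_agree (l : seq ks) (s t : galAut) : Prop :=
  forall x : ks, x \in l -> s x = t x.

Definition continuous1 (T : Type) (c : galAut -> T) : Prop :=
  forall s, exists l : seq ks, forall s', gal_agree l s s' -> c s' = c s.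

Definition continuous2 (T : Type) (d : galAut -> galAut -> T) : Prop :=
  forall s t, exists l : seq ks, forall s' t',
    gal_agree l s s' -> gal_agree l t t' -> d s' t' = d s t.

Section Cohomology.

Variable A : groupFunctor k.

Definition gal_act (s : galAut) (x : A kAlg_sep) : A kAlg_sep := pmap A s x.

Definition Z1 (c : galAut -> A kAlg_sep) : Prop :=
  continuous1 c /\
  (forall s t, c (gal_mul s t) = pmul (c s) (gal_act s (c t))).

Definition H1_trivial : Prop :=
  forall c, Z1 c ->
    exists h : A kAlg_sep, forall s, c s = pmul (pinv h) (gal_act s h).

(* Z2 and H2 are only used for commutative A. *)
Definition Z2 (d : galAut -> galAut -> A kAlg_sep) : Prop :=
  continuous2 d /\
  (forall s t r,
     pmul (gal_act s (d t r)) (d s (gal_mul t r)) =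
     pmul (d (gal_mul s t) r) (d s t)).

Definition cobound (e : galAut -> A kAlg_sep) (s t : galAut) : A kAlg_sep :=
  pmul (pmul (e s) (gal_act s (e t))) (pinv (e (gal_mul s t))).

Definition cohomologous2 (d d' : galAut -> galAut -> A kAlg_sep) : Prop :=
  exists e : galAut -> A kAlg_sep, continuous1 e /\
    (forall s t, d' s t = pmul (d s t) (cobound e s t)).

(* An element of H^2 is a cohomology class, as a set of cocycles. *)
Definition H2_class (d : galAut -> galAut -> A kAlg_sep) :
  (galAut -> galAut -> A kAlg_sep) -> Prop :=
  fun d' => Z2 d' /\ cohomologous2 d d'.

Definition H2_zero := H2_class (fun _ _ => pone A kAlg_sep).

End Cohomology.

Variables (G : groupFunctor k) (n : nat) (rho : representation G n).
Variable f : quotient_point rho.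

Definition fixes (v : 'cV[ks]_n) (h : G kAlg_sep) : Prop :=
  rep_mx rho h *m v = v.

Definition transitive_on_fiber : Prop :=
  (exists v : 'cV[ks]_n, fiber f (v : 'cV[kAlg_sep]_n)) /\
  (forall v w : 'cV[ks]_n,
     fiber f (v : 'cV[kAlg_sep]_n) -> fiber f (w : 'cV[kAlg_sep]_n) ->
     exists h : G kAlg_sep, rep_mx rho h *m v = w).

Definition abelian_stabilizers : Prop :=
  forall v : 'cV[ks]_n, fiber f (v : 'cV[kAlg_sep]_n) ->
    forall a b : G kAlg_sep, fixes v a -> fixes v b -> pmul a b = pmul b a.

(* A k-group scheme Gf together with isomorphisms iota v : Gf(ks) -> G_v for
   v in V_f(ks), as produced by descent. *)
Record stabilizer_descent := StabilizerDescent {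
  Gf :> groupFunctor k;
  Gf_affine : affine_group Gf;
  Gf_comm : commutative_group Gf;
  iota : 'cV[ks]_n -> Gf kAlg_sep -> G kAlg_sep;
  iota_mul : forall v, fiber f (v : 'cV[kAlg_sep]_n) ->
    forall a b, iota v (pmul a b) = pmul (iota v a) (iota v b);
  iota_inj : forall v, fiber f (v : 'cV[kAlg_sep]_n) -> injective (iota v);
  iota_img : forall v, fiber f (v : 'cV[kAlg_sep]_n) ->
    forall h, fixes v h <-> exists b, iota v b = h;
  iota_conj : forall v, fiber f (v : 'cV[kAlg_sep]_n) ->
    forall h b,
      iota (rep_mx rho h *m v) b = pmul (pmul h (iota v b)) (pinv h);
  iota_gal : forall v, fiber f (v : 'cV[kAlg_sep]_n) ->
    forall (s : galAut) b,
      gal_act s (iota v b) = iota (map_mx s v) (gal_act s b) }.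

(* d is the 2-cocycle attached to the choices of v and of g. *)
Definition df_cocycle (D : stabilizer_descent) (v : 'cV[ks]_n)
    (g : galAut -> G kAlg_sep) (d : galAut -> galAut -> D kAlg_sep) : Prop :=
  [/\ fiber f (v : 'cV[kAlg_sep]_n),
      continuous1 g,
      forall s, rep_mx rho (g s) *m map_mx s v = v &
      forall s t, @iota D v (d s t) =
        pmul (pmul (g s) (gal_act s (g t))) (pinv (g (gal_mul s t)))].

(* The cohomology class common to all choices. *)
Definition df (D : stabilizer_descent) :
  (galAut -> galAut -> D kAlg_sep) -> Prop :=
  fun d' => exists v g d, df_cocycle v g d /\ H2_class d d'.

Definition trivializes (g : 'M[ks]_n) (c : galAut -> G kAlg_sep) : Prop :=
  g \in unitmx /\ (forall s, rep_mx rho (c s) = invmx g *m map_mx s g).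

(* V_f^c(k), where g trivializes the image of c in GL(V)(ks). *)
Definition twisted_fiber (g : 'M[ks]_n) (w : 'cV[k]_n) : Prop :=
  exists v : 'cV[ks]_n,
    fiber f (v : 'cV[kAlg_sep]_n) /\ map_mx i w = g *m v.

End Galois.

Arguments kAlg_sep {k ks} i.
Arguments H1_trivial {k ks} i A.
Arguments H2_zero {k ks} i A.
Arguments transitive_on_fiber {k ks} i {G n rho} f.
Arguments abelian_stabilizers {k ks} i {G n rho} f.
Arguments stabilizer_descent {k ks} i {G n rho} f.
Arguments iota {k ks i G n rho f} D v b : rename.
Arguments df {k ks i G n rho f} D d' : rename.
Arguments twisted_fiber {k ks} i {G n rho} f g w.
Arguments trivializes {k ks i G n} rho g c.

(* Main.v *)
From HB Require Import structures.
From mathcomp Require Import all_boot all_algebra all_field.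
From mathcomp Require Import boolp classical_sets mpoly.
(* [Defs] comes last because [galois] also exports a [gal_mul]. *)
Require Import Defs.

Set Implicit Arguments.
Unset Strict Implicit.
Unset Printing Implicit Defensive.

Import GRing.Theory.
Local Open Scope ring_scope.

(* Both sides are equivalent to the existence of a 1-cocycle [c] with values in
   [G(ks)] and of [v] in [V_f(ks)] with [c_s (s v) = v] for all [s].
   - For any [g] with [g_s (s v) = v], multiplying [g] by [iota_v(e)] multiplies
     the cocycle [d] attached to [g] by the coboundary of [e].  So if [e] kills
     [d_f], then [iota_v(e) g] is such a [c].  Conversely such a [c] is a choice
     of [g] with trivial [d], and by transitivity any other choice is obtained
     from [c] by moving [v] and multiplying by some [iota_v(e)].
   - Given [c] and [v], Hilbert 90 for [GL_n] provides [g] with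
     [rho(c_s) = g^-1 (s g)], so [g v] is Galois invariant, hence rational.
   The fixed field of the automorphisms of [ks] is [k] because, by Zorn's lemma,
   an isomorphism between two subalgebras of [ks] extends to [ks].  Such an
   isomorphism is treated as its graph, a subring of [ks * ks], so that a
   polynomial over the graph is a pair of corresponding polynomials. *)

Lemma finite_transversal (T : Type) (U : eqType) (phi : T -> U) (W : seq U) :
  (forall x, phi x \in W) ->
  exists d (t : 'I_d -> T),
    injective (phi \o t) /\ forall x, exists j, phi (t j) = phi x.
Proof.
move=> phiW; pose V := undup [seq w <- W | `[< exists x, phi x = w >]].
have phiV x : phi x \in V.
  by rewrite mem_undup mem_filter phiW andbT; apply/asboolP; exists x.
have lift_tnth j : exists x, phi x = tnth (in_tuple V) j.
  have := mem_tnth j (in_tuple V).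
  by rewrite mem_undup mem_filter => /andP[/asboolP].
have [t tE] := choice lift_tnth; exists (size V), t; split=> [j j' /=|x].
  by rewrite !tE; apply/tuple_uniqP; exact: undup_uniq.
by have /seq_tnthP[j ->] := phiV x; exists j.
Qed.

Lemma finite_roots (F : fieldType) (p : {poly F}) :
  p != 0 -> exists2 rs : seq F, uniq rs & forall x, (x \in rs) = root p x.
Proof.
have [m] := ubnP (size p); elim: m p => // m IH p; rewrite ltnS => pm p0.
have [[x /factor_theorem[q Eq]]|nr] := pselect (exists x, root p x); last first.
  by exists [::] => // x; apply/esym/negP => rx; apply: nr; exists x.
have q0 : q != 0 by apply: contraNneq p0 => q0; rewrite Eq q0 mul0r.
have [|//|rs _ rsE] := IH q.
  by rewrite Eq size_Mmonic ?monicXsubC // size_XsubC addn2 in pm.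
exists (undup (x :: rs)) => [|y]; first exact: undup_uniq.
by rewrite mem_undup inE rsE Eq rootM root_XsubC orbC.
Qed.

Lemma dedekind_independence (R : pzSemiRingType) (S : mulrClosed R)
    (F : fieldType) (V : lmodType F) (I : eqType)
    (chi : I -> {rmorphism R -> F}) (s : seq I) (v : I -> V) :
  uniq s ->
  {in s &, forall i j, i != j -> exists2 a, a \in S & chi i a != chi j a} ->
  (forall a, a \in S -> \sum_(i <- s) chi i a *: v i = 0) ->
  {in s, forall i, v i = 0}.
Proof.
elim: s v => // j s IH v /= /andP[js us] sep sum0.
have v0 : {in s, forall i, v i = 0}.
  move=> i si; have ij : i != j by apply: contraNneq js => <-.
  have [|//||a Sa] := sep i j; rewrite ?inE ?si ?eqxx ?orbT //.
  rewrite -subr_eq0 => /negPf chi_ij.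
  suff /eqP : (chi i a - chi j a) *: v i = 0.
    by rewrite scaler_eq0 chi_ij => /eqP.
  apply: (IH (fun l => (chi l a - chi j a) *: v l)) => // [l l' sl sl'|b Sb].
    by apply: sep; rewrite inE (sl, sl') orbT.
  transitivity (\sum_(l <- j :: s) chi l b *: ((chi l a - chi j a) *: v l)).
    by rewrite big_cons subrr scale0r scaler0 add0r.
  transitivity (\sum_(l <- j :: s) (chi l (b * a) *: v l)
      - chi j a *: \sum_(l <- j :: s) chi l b *: v l).
    rewrite scaler_sumr -sumrB; apply: eq_bigr => l _.
    by rewrite !scalerA -scalerBl mulrBr rmorphM [chi j a * _]mulrC.
  by rewrite !sum0 ?rpredM // scaler0 subr0.
move=> i; rewrite inE => /predU1P[-> {i}|/v0 //].
have := sum0 1 (rpred1 S); rewrite big_cons rmorph1 scale1r big_seq.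
by rewrite big1 ?addr0 // => i /v0 ->; rewrite scaler0.
Qed.

Lemma unitmx_of_spanning_rows (F : fieldType) n (P : 'rV[F]_n -> Prop) :
  (forall u : 'cV_n, (forall x, P x -> x *m u = 0) -> u = 0) ->
  exists2 g : 'M_n, g \in unitmx & forall j, P (row j g).
Proof.
move=> span; pose rows_in m (N : 'M[F]_(m, n)) := forall j, P (row j N).
pose rank_attained d :=
  `[< exists m (N : 'M_(m, n)), rows_in m N /\ \rank N = d >].
have [||d /asboolP[m [N [PN rN]]] dmax] := @ex_maxnP rank_attained n.
- by exists 0%N; apply/asboolP; exists 0%N, 0; split=> [[]|]//; exact: mxrank0.
- by move=> d /asboolP[m [N [_ <-]]]; exact: rank_leq_col.
have P_sub x : P x -> (x <= N)%MS.
  move=> Px; have sN : (N <= col_mx N x)%MS by rewrite -addsmxE addsmxSl.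
  suff : (col_mx N x <= N)%MS by rewrite col_mx_sub => /andP[].
  rewrite -(mxrank_leqif_sup sN) eqn_leq mxrankS //= rN.
  apply: dmax; apply/asboolP; exists (m + 1)%N, (col_mx N x); split=> // j.
  by case: (split_ordP j) => j' ->; rewrite (rowKu, rowKd) // (row_id j').
have fN : row_full N.
  rewrite -cokermx_eq0; apply/eqP/trmx_inj/row_matrixP => j.
  rewrite trmx0 row0 -tr_col (span (col j _)) ?trmx0 // => x /P_sub.
  by rewrite submxE colE mulmxA => /eqP ->; rewrite mul0mx.
exists (rowsub (fullrankfun fN) N) => [|j]; first exact: fullrowsub_unit.
by rewrite row_rowsub.
Qed.

Lemma rmodp_polyOver (R : nzRingType) (S : subringClosed R) :
  {in polyOver S &, forall p q, Pdiv.Ring.rmodp p q \is a polyOver S}.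
Proof.
move=> p q Sp Sq.
have Slead r : r \is a polyOver S -> lead_coef r \in S.
  by move/polyOverP; apply.
have rec_over n m u r : r \is a polyOver S ->
    (Pdiv.CommonRing.redivp_rec q m u r n).2 \is a polyOver S.
  elim: n m u r => [|n IH] m u r Sr /=; case: ifP => // _; last apply: IH;
    by rewrite rpredB ?rpredM ?polyOverC ?polyOverZ ?polyOverXn ?Slead.
rewrite /Pdiv.CommonRing.rmodp /Pdiv.CommonRing.redivp locked_withE.
rewrite /Pdiv.CommonRing.redivp_expanded_def.
by case: ifP => // _; exact: rec_over.
Qed.

Definition adjoin (R : nzRingType) (S : {pred R}) (x : R) : {pred R} :=
  fun y => `[< exists2 p, p \is a polyOver S & y = p.[x] >].

Lemma adjoinP (R : nzRingType) (S : {pred R}) (x y : R) :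
  reflect (exists2 p, p \is a polyOver S & y = p.[x]) (y \in adjoin S x).
Proof. exact: asboolP. Qed.

Section AdjoinSubring.

Variables (R : comNzRingType) (S : subringClosed R) (x : R).

Lemma adjoin_subring_closed : subring_closed (adjoin S x).
Proof.
split=> [|_ _ /adjoinP[p Sp ->] /adjoinP[q Sq ->]
         |_ _ /adjoinP[p Sp ->] /adjoinP[q Sq ->]].
- by apply/adjoinP; exists 1; rewrite ?rpred1 // hornerC.
- by apply/adjoinP; exists (p - q); rewrite ?rpredB // hornerD hornerN.
- by apply/adjoinP; exists (p * q); rewrite ?rpredM // hornerM.
Qed.

HB.instance Definition _ :=
  GRing.isSubringClosed.Build R (adjoin S x) adjoin_subring_closed.

Lemma subset_adjoin : {subset S <= adjoin S x}.
Proof.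
by move=> a Sa; apply/adjoinP; exists a%:P; rewrite ?polyOverC ?hornerC.
Qed.

Lemma mem_adjoin : x \in adjoin S x.
Proof. by apply/adjoinP; exists 'X; rewrite ?polyOverX ?hornerX. Qed.

End AdjoinSubring.

Lemma subring_closed_bigcup_chain (R : pzRingType) (I : Type) (F : set I)
    (S : I -> R -> bool) :
  (F !=set0)%classic -> (forall j, F j -> subring_closed (S j)) ->
  total_on F (fun j l => {subset S j <= S l}) ->
  subring_closed (fun x => `[< exists2 j, F j & x \in S j >]).
Proof.
move=> [j0 Fj0] ringS totF; set U : {pred R} := fun x => _.
have in_common x y : x \in U -> y \in U ->
    exists j, [/\ F j, x \in S j & y \in S j].
  move=> /asboolP[j Fj Sx] /asboolP[l Fl Sy].
  by have [sub|sub] := totF j l Fj Fl; [exists l | exists j]; split; auto.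
split=> [|x y Ux Uy|x y Ux Uy]; apply/asboolP.
- by exists j0 => //; case: (ringS j0 Fj0).
- have [j [Fj Sx Sy]] := in_common x y Ux Uy; have [_ SB _] := ringS j Fj.
  by exists j => //; exact: SB.
- have [j [Fj Sx Sy]] := in_common x y Ux Uy; have [_ _ SM] := ringS j Fj.
  by exists j => //; exact: SM.
Qed.

Lemma subringClosed_of (R : pzRingType) (S : R -> bool) :
  subring_closed S -> exists T : subringClosed R, T = S :> {pred R}.
Proof.
move=> ringS; pose mixin := GRing.isSubringClosed.Build R S ringS.
by exists (HB.pack_for (subringClosed R) S mixin).
Qed.

Lemma kHom_root (k : fieldType) (A B : kAlg k) (u : kHom A B) (p : {poly k})
    (x : A) :
  root (map_poly (kalg_map A) p) x -> root (map_poly (kalg_map B) p) (u x).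
Proof.
move=> /rootP px; apply/rootP.
by rewrite -(eq_map_poly (khom_comm u)) map_poly_comp horner_map /= px rmorph0.
Qed.

Section AlgebraicExtension.

Variables (k K : fieldType) (i : {rmorphism k -> K}).
Hypothesis algK : forall x : K, algebraicOver i x.

Lemma kHom_bij (u : kHom (kAlg_sep i) (kAlg_sep i)) : bijective u.
Proof.
have uI : injective u := fmorph_inj (khom_map u).
have surj y : exists x, u x = y.
  have [p p0 py] := algK y.
  have [|rs urs rsE] := @finite_roots _ (map_poly i p).
    by rewrite map_poly_eq0.
  have urs_rs : {subset map u rs <= rs}.
    by move=> _ /mapP[x xrs ->]; rewrite rsE; apply: kHom_root; rewrite -rsE.
  have [||_ rs_urs] := uniq_min_size _ urs_rs _;
    rewrite ?map_inj_uniq ?size_map //.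
  by move: py; rewrite -rsE -rs_urs => /mapP[x _ ->]; exists x.
have [v uv] := choice surj.
by exists v => // x; apply: uI.
Qed.

Definition diagonal (a : k) : K * K := (i a, i a).

Lemma diagonal_zmod : zmod_morphism diagonal.
Proof. by move=> a b; rewrite /diagonal rmorphB. Qed.

Lemma diagonal_monoid : monoid_morphism diagonal.
Proof. by split=> [|a b]; rewrite /diagonal ?rmorph1 ?rmorphM. Qed.

HB.instance Definition _ :=
  GRing.isZmodMorphism.Build k (K * K)%type diagonal diagonal_zmod.
HB.instance Definition _ :=
  GRing.isMonoidMorphism.Build k (K * K)%type diagonal diagonal_monoid.

Lemma map_fst_diagonal (p : {poly k}) :
  map_poly fst (map_poly diagonal p) = map_poly i p.
Proof. by rewrite -map_poly_comp. Qed.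

Lemma map_snd_diagonal (p : {poly k}) :
  map_poly snd (map_poly diagonal p) = map_poly i p.
Proof. by rewrite -map_poly_comp. Qed.

Lemma horner_pair (p : {poly K * K}) (z : K * K) :
  p.[z] = ((map_poly fst p).[z.1], (map_poly snd p).[z.2]).
Proof. by rewrite !horner_map; case: (p.[z]). Qed.

(* The graph of an isomorphism between two k-subalgebras of K is a subring of
   K * K on which both projections are injective. It is enough to ask it of the
   first projection, see [iso_graph_inj]. *)
Definition iso_graph (S : {pred K * K}) : Prop :=
  [/\ subring_closed S, forall a, diagonal a \in S &
      forall y, (0, y) \in S -> y = 0].

Section IsoGraph.

Variables (S : subringClosed (K * K)%type) (graphS : iso_graph S).

Lemma iso_graph_fun x y y' : (x, y) \in S -> (x, y') \in S -> y = y'.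
Proof.
case: graphS => _ _ S0 Sy Sy'; apply/subr0_eq/S0.
have -> : (0, y - y') = (x, y) - (x, y') by rewrite -(subrr x).
exact: rpredB.
Qed.

Lemma diagonal_polyOver p : map_poly diagonal p \is a polyOver S.
Proof.
by case: graphS => _ Sdiag _; apply/polyOverP => j; rewrite coef_map Sdiag.
Qed.

(* A nonzero x is a root of a polynomial over k with nonzero constant term, and
   the graph contains the pair of its values at x and at the image of x. *)
Lemma iso_graph_inj x : (x, 0) \in S -> x = 0.
Proof.
move=> Sx0; apply/eqP/negPn/negP => x0.
have [p p0 px] := algK x; have [m [q q0 Eq]] := multiplicity_XsubC p 0.
rewrite p0 /= in q0; case: graphS => _ _ S0.
have qx : (map_poly i q).[x] = 0.
  move: px; rewrite Eq subr0 rmorphM /= map_polyXn rootM => /orP[/rootP//|].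
  by rewrite rootE hornerXn expf_eq0 (negPf x0) andbF.
have : (map_poly diagonal q).[(x, 0)] \in S.
  by rewrite rpred_horner ?diagonal_polyOver.
rewrite horner_pair map_fst_diagonal map_snd_diagonal qx => /S0/eqP.
rewrite horner_coef0 coef_map fmorph_eq0 -horner_coef0.
exact/negP.
Qed.

Lemma lead_coef_iso_graph P : P \is a polyOver S -> P != 0 ->
  (lead_coef P).1 != 0 /\ (lead_coef P).2 != 0.
Proof.
move=> /polyOverP SP; rewrite -lead_coef_eq0 lead_coefE.
case: graphS => _ _ S0; case: (P`_ _) (SP (size P).-1) => a b /= Sab ab0.
split; apply: contraNneq ab0 => e; rewrite e in Sab *.
  by rewrite (S0 b).
by rewrite (iso_graph_inj Sab).
Qed.

Definition min_annihilator (x : K) (P : {poly K * K}) : Prop :=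
  [/\ P \is a polyOver S, P != 0, root (map_poly fst P) x &
      forall Q, Q \is a polyOver S -> root (map_poly fst Q) x ->
        (size Q < size P)%N -> Q = 0].

Lemma min_annihilator_exists x : exists P, min_annihilator x P.
Proof.
pose attained m := `[< exists P, [/\ P \is a polyOver S, P != 0,
  root (map_poly fst P) x & size P = m] >].
have : exists m, attained m.
  have [p p0 px] := algK x; exists (size (map_poly diagonal p)).
  apply/asboolP; exists (map_poly diagonal p).
  split; rewrite ?diagonal_polyOver ?map_fst_diagonal //.
  apply: contraNneq p0 => diag0.
  by rewrite -(map_poly_eq0 i) -map_fst_diagonal diag0 rmorph0.
case/ex_minnP => m /asboolP[P [SP P0 Px sP]] mmin.
exists P; split=> // Q SQ Qx; rewrite sP ltnNge.
by apply: contraNeq => Q0; apply: mmin; apply/asboolP; exists Q.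
Qed.

Variables (x : K) (P : {poly K * K}) (minP : min_annihilator x P).

(* Pseudo-division, as leading coefficients need not be invertible in S. *)
Lemma min_annihilator_dvdp Q : Q \is a polyOver S ->
  root (map_poly fst Q) x -> map_poly snd P %| map_poly snd Q.
Proof.
case: minP => SP P0 Px Pmin SQ Qx.
have eqQ := Pdiv.ComRing.rdivp_eq P Q.
have remE : Pdiv.Ring.rmodp Q P = 0.
  apply: Pmin; [exact: rmodp_polyOver | | by rewrite Pdiv.Ring.ltn_rmodp].
  have -> : Pdiv.Ring.rmodp Q P =
      lead_coef P ^+ Pdiv.Ring.rscalp Q P *: Q - Pdiv.Ring.rdivp Q P * P.
    by rewrite eqQ addrC addKr.
  rewrite -mul_polyC rmorphB !rmorphM rootE !hornerE.
  by rewrite (rootP Px) (rootP Qx) !mulr0 subr0.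
have [_ leadP] := lead_coef_iso_graph SP P0.
have := congr1 (map_poly snd) eqQ; rewrite remE addr0 map_polyZ rmorphM => sndQ.
rewrite -(@dvdpZr _ (lead_coef P ^+ Pdiv.Ring.rscalp Q P).2).
  by rewrite sndQ dvdp_mull.
by rewrite rmorphXn expf_neq0.
Qed.

Lemma min_annihilator_separable p : separable_poly p -> root (map_poly i p) x ->
  separable_poly (map_poly snd P).
Proof.
move=> sep_p px; have := min_annihilator_dvdp (diagonal_polyOver p).
rewrite map_fst_diagonal map_snd_diagonal => /(_ px) /dvdp_separable; apply.
by rewrite separable_map.
Qed.

Lemma size_min_annihilator : (1 < size (map_poly snd P))%N.
Proof.
case: minP => SP P0 Px _; have [lead1 lead2] := lead_coef_iso_graph SP P0.
have p0 : map_poly fst P != 0 by rewrite map_poly_eq0_id0.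
by have := root_size_gt1 p0 Px; rewrite !size_map_poly_id0.
Qed.

Lemma iso_graph_adjoin y : root (map_poly snd P) y ->
  exists T, [/\ iso_graph T, {subset S <= T} & (x, y) \in T].
Proof.
move=> Py; exists (adjoin S (x, y)).
split; [|exact: subset_adjoin|exact: mem_adjoin].
split; first exact: adjoin_subring_closed.
  by move=> a; apply: subset_adjoin; case: graphS.
move=> b /adjoinP[Q SQ]; rewrite horner_pair => -[/esym/rootP Qx ->].
apply/rootP; move: Py; rewrite !root_factor_theorem => /dvdp_trans; apply.
exact: min_annihilator_dvdp.
Qed.

End IsoGraph.

Lemma iso_graph_bigcup_chain (I : Type) (F : set I) (S : I -> K * K -> bool) :
  (F !=set0)%classic -> (forall j, F j -> iso_graph (S j)) ->
  total_on F (fun j l => {subset S j <= S l}) ->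
  iso_graph (fun z => `[< exists2 j, F j & z \in S j >]).
Proof.
move=> F0 graphS totF; split=> [|a|y /asboolP[j Fj]].
- by apply: subring_closed_bigcup_chain => // j /graphS[].
- case: F0 => j Fj; apply/asboolP; exists j => //.
  by case: (graphS j Fj) => _ Sdiag _; exact: Sdiag.
- by case: (graphS j Fj) => _ _; apply.
Qed.

Lemma iso_graph_maximal S : iso_graph S ->
  exists M, [/\ iso_graph M, {subset S <= M} &
    forall T, iso_graph T -> {subset M <= T} -> {subset T <= M}].
Proof.
move=> graphS.
pose extends (T : K * K -> bool) := iso_graph T /\ {subset S <= T}.
pose extS : {T | extends T} := exist _ S (conj graphS (fun z Sz => Sz)).
pose leT (M T : {T | extends T}) := `[< {subset sval M <= sval T} >].
have [||F totF|[M [graphM SM]] maxM] := @ZL_preorder _ extS leT.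
- by move=> T; apply/asboolP.
- by move=> T M N /asboolP TM /asboolP MN; apply/asboolP => z /TM /MN.
- have [[T0 FT0]|F0] := pselect (F !=set0)%classic; last first.
    by exists extS => T FT; case: F0; exists T.
  pose U z := `[< exists2 T, F T & z \in sval T >].
  have subU T : F T -> {subset sval T <= U}.
    by move=> FT z Tz; apply/asboolP; exists T.
  have extU : extends U.
    split=> [|z Sz].
      apply: iso_graph_bigcup_chain => [|T _|T T' FT FT']; first by exists T0.
        by case: (svalP T).
      by have [/asboolP|/asboolP] := totF T T' FT FT'; [left | right].
    by apply: (subU T0) => //; case: (svalP T0) => _; apply.
  by exists (exist extends U extU) => T FT; apply/asboolP; exact: subU.
exists M; split=> // T graphT MT.
have extT : extends T by split=> // z /SM /MT.
exact/asboolP/(maxM (exist extends T extT))/asboolP.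
Qed.

Definition diagonal_image : {pred K * K} :=
  fun z => `[< exists a, z = diagonal a >].

Lemma diagonal_image_subring : subring_closed diagonal_image.
Proof.
split=> [|_ _ /asboolP[a ->] /asboolP[b ->]|_ _ /asboolP[a ->] /asboolP[b ->]];
  apply/asboolP; [exists 1|exists (a - b)|exists (a * b)].
- by rewrite rmorph1.
- by rewrite rmorphB.
- by rewrite rmorphM.
Qed.

HB.instance Definition _ :=
  GRing.isSubringClosed.Build (K * K)%type diagonal_image
    diagonal_image_subring.

Lemma iso_graph_diagonal : iso_graph diagonal_image.
Proof.
split=> [|a|y /asboolP[a [/eqP]]]; first exact: diagonal_image_subring.
  by apply/asboolP; exists a.
by rewrite eq_sym fmorph_eq0 => /eqP -> ->; rewrite rmorph0.
Qed.

End AlgebraicExtension.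

Lemma kHom_of_fun (k : fieldType) (A B : kAlg k) (phi : A -> B) :
  zmod_morphism phi -> monoid_morphism phi ->
  (forall a, phi (kalg_map A a) = kalg_map B a) ->
  exists u : kHom A B, u =1 phi.
Proof.
move=> phiB phiM phik.
pose zmod_mixin := GRing.isZmodMorphism.Build A B phi phiB.
pose monoid_mixin := GRing.isMonoidMorphism.Build A B phi phiM.
pose u : {rmorphism A -> B} := HB.pack phi zmod_mixin monoid_mixin.
by exists (@KHom k A B u phik).
Qed.

Section SeparableClosure.

Variables (k ks : fieldType) (i : {rmorphism k -> ks}).
Hypothesis hks : is_separable_closure i.

Lemma separable_closure_algebraic x : algebraicOver i x.
Proof.
by have [p [sp px]] := hks.1 x; exists p; first exact: separable_poly_neq0.
Qed.
Let algK := separable_closure_algebraic.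

Lemma iso_graph_extend (S : subringClosed (ks * ks)%type) x : iso_graph i S ->
  exists y T, [/\ iso_graph i T, {subset S <= T} & (x, y) \in T].
Proof.
move=> graphS; have [P minP] := min_annihilator_exists algK graphS x.
have [p [sep_p px]] := hks.1 x.
have sepP := min_annihilator_separable algK graphS minP sep_p px.
have [y Py] := hks.2 _ sepP (size_min_annihilator algK graphS minP).
by exists y; exact: iso_graph_adjoin minP y Py.
Qed.

Lemma galAut_extending (S : ks * ks -> bool) : iso_graph i S ->
  exists s : galAut i, forall a b, (a, b) \in S -> s a = b.
Proof.
move=> graphS; have [M [graphM SM maxM]] := iso_graph_maximal graphS.
have [ringM Mdiag _] := graphM; have [R RE] := subringClosed_of ringM.
rewrite -{}RE in ringM Mdiag graphM SM maxM; have [M1 MB MM] := ringM.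
have totM x : exists y, (x, y) \in R.
  have [y [T [graphT MT Txy]]] := iso_graph_extend x graphM.
  by exists y; exact: maxM Txy.
have [phi Mphi] := choice totM.
have phiE a b : (a, b) \in R -> phi a = b.
  exact: (iso_graph_fun graphM (Mphi a)).
have [||a|u uE] := @kHom_of_fun k (kAlg_sep i) (kAlg_sep i) phi.
- by move=> a b; apply: phiE; exact: (MB (_, _) (_, _)).
- by split=> [|a b]; apply: phiE; [exact: M1 | exact: (MM (_, _) (_, _))].
- exact/phiE/Mdiag.
by exists (GalAut (kHom_bij algK u)) => a b Sab; rewrite -(phiE a b) ?SM.
Qed.

Lemma galois_fixed x : (forall s : galAut i, s x = x) -> exists a, x = i a.
Proof.
move=> fixx; have graphS := iso_graph_diagonal i.
have [P minP] := min_annihilator_exists algK graphS x.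
have [SP P0 Px _] := minP.
have diagP j : exists a, P`_j = diagonal i a.
  by have /asboolP := polyOverP SP j.
set q := map_poly snd P.
have qi j : exists a, q`_j = i a.
  by have [a Pa] := diagP j; exists a; rewrite coef_map Pa.
have fstP : map_poly fst P = q.
  by apply/polyP => j; have [a Pa] := diagP j; rewrite !coef_map Pa.
have roots_q y : root q y -> y = x.
  move=> qy; have [T [graphT _ Txy]] := iso_graph_adjoin algK graphS minP qy.
  by have [s sT] := galAut_extending graphT; rewrite -(fixx s) (sT x y).
have sep_q : separable_poly q.
  have [p [sep_p px]] := hks.1 x.
  exact: (min_annihilator_separable algK graphS minP sep_p px).
have [u qE] : exists u, q = u * ('X - x%:P).
  by apply: factor_theorem; rewrite -fstP.
have q0 : q != 0 := separable_poly_neq0 sep_q.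
have u0 : u != 0 by apply: contraNneq q0 => u0; rewrite qE u0 mul0r.
have u_const : (size u <= 1)%N.
  rewrite leqNgt; move: sep_q; rewrite qE separable_root => /andP[sep_u ux].
  apply: contraNN ux => /(hks.2 u sep_u)[y uy].
  by rewrite -(roots_q y) // qE rootM uy.
have [c uE] : exists c, u = c%:P by exists u`_0; exact: size1_polyC.
have c0 : c != 0 by rewrite uE polyC_eq0 in u0.
have [a qa] := qi 1%N; have [b qb] := qi 0%N.
exists (- b / a); rewrite rmorphM rmorphN fmorphV -qa -qb qE uE.
rewrite !coefCM !coefB !coefX !coefC /= subr0 sub0r mulrN opprK mulr1.
by rewrite mulrAC divff ?mul1r.
Qed.

Lemma galois_fixed_mx m n (x : 'M[ks]_(m, n)) :
  (forall s : galAut i, map_mx s x = x) ->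
  exists w : 'M[k]_(m, n), map_mx i w = x.
Proof.
move=> fixx.
have entry_fixed (e : 'I_m * 'I_n) : exists a, x e.1 e.2 = i a.
  by apply: galois_fixed => s; rewrite -[in RHS](fixx s) mxE.
have [w wE] := choice entry_fixed; exists (\matrix_(a, b) w (a, b)).
by apply/matrixP => a b; rewrite !mxE -(wE (a, b)).
Qed.

End SeparableClosure.

Section GaloisGroup.

Variables (k ks : fieldType) (i : {rmorphism k -> ks}).
Implicit Types (s t : galAut i) (l : seq ks).

Lemma galAut_ext s t : s =1 t -> s = t.
Proof.
case: s t => [s bs] [t bt] /= /(@kHom_ext _ _ _ s t) st.
by case: _ / st bt => bt; rewrite (Prop_irrelevance bs bt).
Qed.

Definition gal_id : galAut i :=
  @GalAut k ks i (kHom_id _) (Bijective (fun=> erefl) (fun=> erefl)).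

Lemma gal_mul_surj s t : exists u, gal_mul s u = t.
Proof.
have [s' sK s'K] := gal_bij s.
have [||a|r rE] := @kHom_of_fun k (kAlg_sep i) (kAlg_sep i) s'.
- exact: can2_zmod_morphism sK s'K.
- exact: can2_monoid_morphism sK s'K.
- by rewrite -{1}(khom_comm s) sK.
have bij_r : bijective r by exists s => x; rewrite rE.
exists (gal_mul (GalAut bij_r) t); apply: galAut_ext => x /=.
by rewrite rE s'K.
Qed.

Lemma map_gal_agree l s t : map s l = map t l <-> gal_agree l s t.
Proof. by split=> /eq_in_map. Qed.

Lemma gal_agree_mul2l l r s t :
  gal_agree l (gal_mul r s) (gal_mul r t) <-> gal_agree l s t.
Proof.
have rI := bij_inj (gal_bij r).
by split=> st x /st => [/rI//|/(congr1 r)].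
Qed.

(* By Galois theory, this is the subfield generated by l over k. *)
Definition gal_definable l : {pred ks} :=
  fun x => `[< forall s t, gal_agree l s t -> s x = t x >].

Lemma mem_gal_definable l : {subset l <= gal_definable l}.
Proof. by move=> x lx; apply/asboolP => s t; apply. Qed.

Lemma gal_definable_subring l : subring_closed (gal_definable l).
Proof.
split=> [|x y /asboolP lx /asboolP ly|x y /asboolP lx /asboolP ly];
  apply/asboolP => s t st.
- by rewrite !rmorph1.
- by rewrite !rmorphB (lx s t) ?(ly s t).
- by rewrite !rmorphM (lx s t) ?(ly s t).
Qed.

HB.instance Definition _ l :=
  GRing.isSubringClosed.Build ks (gal_definable l) (gal_definable_subring l).

Hypothesis algks : forall x : ks, algebraicOver i x.

Lemma gal_orbit_finite l : exists W : seq (seq ks), forall s, map s l \in W.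
Proof.
elim: l => [|x l [W lW]]; first by exists [:: [::]].
have [p p0 px] := algks x.
have [|rs _ rsE] := @finite_roots _ (map_poly i p).
  by rewrite map_poly_eq0.
exists [seq y :: w | y <- rs, w <- W] => s.
apply/allpairsP; exists ((s x : ks), (map s l : seq ks)); split=> //=.
by rewrite rsE; exact: (@kHom_root _ _ _ s).
Qed.

Lemma gal_transversal l : exists d (t : 'I_d -> galAut i),
  (forall j j', gal_agree l (t j) (t j') -> j = j') /\
  forall s, exists j, gal_agree l (t j) s.
Proof.
have [W lW] := gal_orbit_finite l.
have [d [t [t_inj t_surj]]] := finite_transversal lW.
exists d, t; split=> [j j' /map_gal_agree /t_inj //|s].
by have [j /map_gal_agree] := t_surj s; exists j.
Qed.

Section Hilbert90.

Variables (n : nat) (A : galAut i -> 'M[ks]_n) (l : seq ks).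
Hypothesis AM : forall s t, A (gal_mul s t) = A s *m map_mx s (A t).
Hypothesis A1 : forall s, gal_agree l gal_id s -> A s = 1%:M.

Lemma cocycle_agree s t : gal_agree l s t -> A s = A t.
Proof.
have [u <-] := gal_mul_surj s t => su.
rewrite AM (A1 (s := u)) ?map_mx1 ?mulmx1 //.
exact/(gal_agree_mul2l l s).
Qed.

Definition descends m (x : 'M[ks]_(n, m)) : Prop :=
  forall s, A s *m map_mx s x = x.

Lemma descends_col m (x : 'M[ks]_(n, m)) :
  descends x <-> forall c, descends (col c x).
Proof.
split=> [dx c s|dx s]; first by rewrite map_col !colE mulmxA dx.
apply/trmx_inj/row_matrixP => c; rewrite -!tr_col -[in RHS](dx c s).
by rewrite map_col !colE mulmxA.
Qed.

Variables (d : nat) (t : 'I_d -> galAut i).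
Hypothesis t_inj : forall j j', gal_agree l (t j) (t j') -> j = j'.
Hypothesis t_surj : forall s, exists j, gal_agree l (t j) s.

Definition orbit_sum (a : ks) : 'M[ks]_n := \sum_j (t j a : ks) *: A (t j).

Lemma orbit_sum_descends a : a \in gal_definable l -> descends (orbit_sum a).
Proof.
move=> /asboolP la s.
have [p pE] := choice (fun j => t_surj (gal_mul s (t j))).
have p_inj : injective p.
  move=> j j' pjj'; apply/t_inj/(gal_agree_mul2l l s) => x lx.
  by rewrite -!pE // pjj'.
rewrite [RHS](reindex_inj p_inj) /orbit_sum (raddf_sum (map_mx (khom_map s))).
rewrite mulmx_sumr; apply: eq_bigr => j _.
rewrite [X in _ *m X](map_mxZ (khom_map s)) -scalemxAr -AM.
by rewrite (la _ _ (pE j)) (cocycle_agree (pE j)).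
Qed.

(* Artin's argument: by Dedekind's independence, a linear form vanishing on all
   orbit sums vanishes on each A (t j), one of which is the identity. *)
Lemma orbit_sum_separates (u : 'cV[ks]_n) :
  (forall a, a \in gal_definable l -> (orbit_sum a)^T *m u = 0) -> u = 0.
Proof.
move=> u0; have [j0 j0_id] := t_surj gal_id.
suff : (A (t j0))^T *m u = 0.
  by rewrite (A1 (s := t j0)) ?trmx1 ?mul1mx // => x /j0_id.
apply: (@dedekind_independence _ (gal_definable l) _ _ _
  (fun j => khom_map (t j)) (index_enum 'I_d) (fun j => (A (t j))^T *m u))
  => [|j j' _ _ jj'|a la|]; rewrite ?index_enum_uniq ?mem_index_enum //.
- apply: contrapT => no_sep; move/eqP: jj'; apply; apply: t_inj => x lx.
  apply: contrapT => /eqP sep_x; apply: no_sep; exists x => //.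
  exact: mem_gal_definable.
- rewrite -[RHS](u0 a la) /orbit_sum raddf_sum mulmx_suml.
  apply: eq_bigr => j _.
  by rewrite /= linearZ /= scalemxAl.
Qed.

End Hilbert90.

Theorem hilbert90_GL n (A : galAut i -> 'M[ks]_n) l :
  (forall s t, A (gal_mul s t) = A s *m map_mx s (A t)) ->
  (forall s, gal_agree l gal_id s -> A s = 1%:M) ->
  exists g : 'M[ks]_n, g \in unitmx /\ forall s, A s = invmx g *m map_mx s g.
Proof.
move=> AM A1; have [d [t [t_inj t_surj]]] := gal_transversal l.
have [u u0|N uN descN] :=
  @unitmx_of_spanning_rows _ n (fun x => descends A x^T).
  apply: (orbit_sum_separates A1 t_inj t_surj) => a la.
  apply/row_matrixP => c; rewrite row_mul -tr_col row0 u0 // trmxK.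
  apply: (descends_col A (orbit_sum A t a)).1.
  exact: (orbit_sum_descends AM A1 t_inj t_surj la).
have descNT : descends A N^T by apply/descends_col => j; rewrite -tr_row.
exists (invmx N^T); rewrite unitmx_inv unitmx_tr; split=> // s.
by rewrite invmxK map_invmx -{1}(descNT s) mulmxK // map_unitmx unitmx_tr.
Qed.

End GaloisGroup.

Section GroupFunctorPoints.

Local Open Scope group_scope.

Variables (k : fieldType) (G : groupFunctor k).

Section Points.

Variable S : kAlg k.

Lemma pmulxV : right_inverse (pone G S) pinv pmul.
Proof.
move=> x; rewrite -[LHS]pmul1 -(pmulV (pinv x)) -pmulA [pmul _ (pmul x _)]pmulA.
by rewrite pmulV pmul1.
Qed.

Lemma pmulx1 : right_id (pone G S) pmul.
Proof. by move=> x; rewrite -(pmulV x) pmulA pmulxV pmul1. Qed.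

HB.instance Definition _ := gen_eqMixin (G S).
HB.instance Definition _ := gen_choiceMixin (G S).
HB.instance Definition _ :=
  isGroup.Build (G S) (@pmulA k G S) (@pmul1 k G S) pmulx1
    (@pmulV k G S) pmulxV.

Lemma pmulE (x y : G S) : pmul x y = x * y. Proof. by []. Qed.
Lemma poneE : pone G S = 1. Proof. by []. Qed.
Lemma pinvE (x : G S) : pinv x = x^-1. Proof. by []. Qed.

End Points.

Lemma pmap_div (S T : kAlg k) (u : kHom S T) : {morph pmap G u : x y / x / y}.
Proof.
move=> x y; apply: (mulIg (pmap G u y)).
by rewrite -[LHS]pmap_mul pmulE !divgK.
Qed.

HB.instance Definition _ (S T : kAlg k) (u : kHom S T) :=
  isGroupMorphism.Build (G S) (G T) (pmap G u) (pmap_div u).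

Section Representation.

Variables (n : nat) (rho : representation G n) (S : kAlg k).
Implicit Types (h : G S) (v : 'cV[S]_n).

Lemma rep_mulK h v : rep_mx rho h^-1 *m (rep_mx rho h *m v) = v.
Proof. by rewrite mulmxA -rep_mul pmulE mulVg rep_one mul1mx. Qed.

Lemma rep_mulVK h v : rep_mx rho h *m (rep_mx rho h^-1 *m v) = v.
Proof. by rewrite -{1}(invgK h) rep_mulK. Qed.

End Representation.

End GroupFunctorPoints.

Section Evaluation.

Variables (k : fieldType) (S T : kAlg k) (u : kHom S T).

Lemma khom_mmap m (h : 'I_m -> S) (p : {mpoly k[m]}) :
  u (mmap (kalg_map S) h p) = mmap (kalg_map T) (u \o h) p.
Proof.
rewrite /mmap rmorph_sum; apply: eq_bigr => a _; rewrite rmorphM khom_comm.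
congr (_ * _); rewrite rmorph_prod; apply: eq_bigr => b _.
by rewrite rmorphXn.
Qed.

Lemma evalV_map n (v : 'cV[S]_n) (p : {mpoly k[n]}) :
  evalV (map_mx u v) p = u (evalV v p).
Proof.
rewrite /evalV khom_mmap; congr (mmap _ _ p).
by apply/funext => j; rewrite mxE.
Qed.

End Evaluation.

Section Cochains.

Local Open Scope group_scope.

Variables (k ks : fieldType) (i : {rmorphism k -> ks}).
Implicit Types s t : galAut i.

Lemma continuous1_cst T (x : T) : continuous1 (fun _ : galAut i => x).
Proof. by move=> s; exists [::]. Qed.

Lemma continuous1_op T U X (op : T -> U -> X) (c : galAut i -> T)
    (e : galAut i -> U) :
  continuous1 c -> continuous1 e -> continuous1 (fun s => op (c s) (e s)).
Proof.
move=> cc ce s; have [l cl] := cc s; have [l' el'] := ce s.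
exists (l ++ l') => t st; rewrite cl ?el' // => x xl; apply: st.
  by rewrite mem_cat xl orbT.
by rewrite mem_cat xl.
Qed.

Lemma continuous1_inj T U (phi : T -> U) (c : galAut i -> T) :
  injective phi -> continuous1 (phi \o c) -> continuous1 c.
Proof. by move=> phiI cc s; have [l cl] := cc s; exists l => t /cl /phiI. Qed.

(* A point of G in ks is determined by the images of finitely many generators of
   the coordinate ring, hence depends on finitely many elements of ks. *)
Lemma continuous1_gal_act (G : groupFunctor k) (h : G (kAlg_sep i)) :
  algebraic_group G -> continuous1 (fun s : galAut i => gal_act s h).
Proof.
move=> [O [u [repr [m [gen genO]]]]] s; have [phi [<- _]] := repr _ h.
exists [seq (phi (gen j) : ks) | j : 'I_m] => t st.
rewrite /gal_act -!pmap_comp; congr (pmap G _ u); apply: kHom_ext => a /=.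
have [p ->] := genO a; rewrite !khom_mmap; congr (mmap _ _ p).
by apply/funext => j; apply/esym/st; exact/map_f/mem_enum.
Qed.

Lemma gal_actM (A : groupFunctor k) s :
  {morph @gal_act _ _ i A s : x y / x * y}.
Proof. exact: gmulfM. Qed.

Lemma gal_act1 (A : groupFunctor k) s : gal_act s (1 : A (kAlg_sep i)) = 1.
Proof. exact: gmulf1. Qed.

Lemma gal_actV (A : groupFunctor k) s : {morph @gal_act _ _ i A s : x / x^-1}.
Proof. exact: gmulfV. Qed.

Lemma gal_act_comp (A : groupFunctor k) s t (x : A (kAlg_sep i)) :
  gal_act (gal_mul s t) x = gal_act s (gal_act t x).
Proof. exact: pmap_comp. Qed.

Section Cobound.

Variable A : groupFunctor k.
Implicit Types c e : galAut i -> A (kAlg_sep i).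

Lemma coboundE e s t : cobound e s t = e s * gal_act s (e t) / e (gal_mul s t).
Proof. by []. Qed.

Lemma cobound1 s t : cobound (fun=> pone A _) s t = 1.
Proof. by rewrite coboundE poneE gal_act1 mul1g mulgV. Qed.

Lemma Z1_cobound c : Z1 c <-> continuous1 c /\ forall s t, cobound c s t = 1.
Proof.
split=> -[cc cM]; split=> // s t; first by rewrite coboundE cM mulgV.
by apply/esym/divg1_eq; exact: cM.
Qed.

Lemma Z1_one : Z1 (fun _ : galAut i => pone A _).
Proof.
by apply/Z1_cobound; split=> [|s t]; [exact: continuous1_cst|exact: cobound1].
Qed.

Lemma Z2_one : Z2 (fun _ _ : galAut i => pone A (kAlg_sep i)).
Proof. by split=> [s t|s t r]; [exists [::] | rewrite poneE gal_act1]. Qed.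

Lemma Z1_gal_id c : Z1 c -> c (gal_id i) = 1.
Proof.
move=> [_ cM]; have := cM (gal_id i) (gal_id i).
have -> : gal_mul (gal_id i) (gal_id i) = gal_id i by exact: galAut_ext.
by rewrite /gal_act [pmap A _ _]pmap_id pmulE -{1}[c _]mulg1 => /mulgI.
Qed.

Lemma coboundM e c s t : commutative_group A ->
  cobound (fun r => e r * c r) s t = cobound e s t * cobound c s t.
Proof.
move=> commA; have mulC x y : x * y = y * x :> A (kAlg_sep i) by exact: commA.
have mulACA x y z w : x * y * (z * w) = x * z * (y * w) :> A (kAlg_sep i).
  by rewrite -!mulgA; congr (_ * _); rewrite !mulgA (mulC y).
by rewrite !coboundE gal_actM invgM mulACA [_^-1 * _]mulC mulACA.
Qed.

Lemma cobound_conjg c h s t :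
  cobound (fun r => h^-1 * c r * gal_act r h) s t = cobound c s t ^ h.
Proof.
rewrite !coboundE !gal_actM gal_actV -gal_act_comp conjgE !invgM invgK !mulgA.
by rewrite !(mulgK, mulgVK).
Qed.

Lemma cohomologous2_refl (d : galAut i -> galAut i -> A (kAlg_sep i)) :
  cohomologous2 d d.
Proof.
exists (fun=> pone A _); split=> [|s t]; first exact: continuous1_cst.
by rewrite cobound1 pmulE mulg1.
Qed.

Lemma cohomologous2_trans (d d' d'' : galAut i -> galAut i -> A (kAlg_sep i)) :
  commutative_group A ->
  cohomologous2 d d' -> cohomologous2 d' d'' -> cohomologous2 d d''.
Proof.
move=> commA [e [ce dd']] [e' [ce' d'd'']].
exists (fun s => e s * e' s); split=> [|s t]; first exact: continuous1_op.
by rewrite d'd'' dd' coboundM // !pmulE [RHS]mulgA.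
Qed.

End Cobound.

End Cochains.

Section Fiber.

Variables (k : fieldType) (G : groupFunctor k) (n : nat).
Variables (rho : representation G n) (f : quotient_point rho).

Lemma fiber_rep (S : kAlg k) (h : G S) (v : 'cV[S]_n) :
  fiber f v -> fiber f (rep_mx rho h *m v).
Proof.
move=> fv p; rewrite -fv.
by have := inv_polyP p; rewrite unfold_in => /asboolP; exact.
Qed.

Lemma fiber_map (S T : kAlg k) (u : kHom S T) (v : 'cV[S]_n) :
  fiber f v -> fiber f (map_mx u v).
Proof. by move=> fv p; rewrite evalV_map fv khom_comm. Qed.

Lemma fiber_map_inj (S T : kAlg k) (u : kHom S T) (v : 'cV[S]_n) :
  injective u -> fiber f (map_mx u v) -> fiber f v.
Proof. by move=> uI fv p; apply: uI; rewrite -evalV_map fv khom_comm. Qed.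

End Fiber.

Section TwistedPoints.

Local Open Scope group_scope.

Variables (k ks : fieldType) (i : {rmorphism k -> ks}).
Variables (G : groupFunctor k) (n : nat) (rho : representation G n).
Variable f : quotient_point rho.
Implicit Types (c : galAut i -> G (kAlg_sep i)) (h : G (kAlg_sep i)).
Implicit Types (v : 'cV[ks]_n) (s : galAut i).

(* When c is a 1-cocycle, these are the rational points of the twist of the
   fiber by c. *)
Definition twisted_point c v : Prop :=
  fiber f (v : 'cV[kAlg_sep i]_n) /\
  forall s, rep_mx rho (c s) *m map_mx s v = v.

Lemma map_rep_mul s h v :
  map_mx s (rep_mx rho h *m v) = rep_mx rho (gal_act s h) *m map_mx s v.
Proof. by rewrite rep_nat -[RHS]map_mxM. Qed.

Lemma twisted_point_translate c h v :
  twisted_point (fun s => h^-1 * c s * gal_act s h) v <->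
  twisted_point c (rep_mx rho h *m v).
Proof.
split=> -[fv cv].
  split=> [|s]; first exact: fiber_rep.
  by rewrite map_rep_mul -[in RHS](cv s) !rep_mul -!mulmxA rep_mulVK.
split=> [|s]; first by rewrite -(rep_mulK rho h v); exact: fiber_rep.
by rewrite !rep_mul -!mulmxA -map_rep_mul cv rep_mulK.
Qed.

Definition sep_hom : kHom (kAlg_base k) (kAlg_sep i) :=
  @KHom k (kAlg_base k) (kAlg_sep i) i (fun=> erefl).

Hypothesis hks : is_separable_closure i.

Lemma twisted_point1 :
  (exists v, twisted_point (fun=> 1) v) <->
  exists w : 'cV[k]_n, fiber f (w : 'cV[kAlg_base k]_n).
Proof.
split=> [[v [fv fixv]]|[w fw]].
  have [s|w wv] := @galois_fixed_mx _ _ _ hks n 1 v.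
    by rewrite -[in RHS](fixv s) rep_one mul1mx.
  exists w; apply: (@fiber_map_inj _ _ _ _ _ _ _ sep_hom).
    exact: fmorph_inj.
  by rewrite [map_mx _ w]wv.
exists (map_mx i w); split=> [|s]; first exact: (fiber_map sep_hom fw).
by rewrite rep_one mul1mx -map_mx_comp (eq_map_mx _ (khom_comm s)).
Qed.

Lemma twisted_point_trivialize c : Z1 c ->
  (exists v, twisted_point c v) <->
  exists g : 'M[ks]_n, trivializes rho g c /\
    exists w : 'cV[k]_n, twisted_fiber i f g w.
Proof.
move=> Zc; split=> [[v [fv cv]]|[g [[ug cg] [w [v [fv wv]]]]]]; last first.
  exists v; split=> // s.
  rewrite cg -mulmxA -[map_mx s g *m _]map_mxM -wv -map_mx_comp.
  by rewrite (eq_map_mx _ (khom_comm s)) [map_mx _ w]wv mulKmx.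
have [l cl] := Zc.1 (gal_id i).
have [s t||g [ug cg]] := @hilbert90_GL _ _ _ (separable_closure_algebraic hks)
  n (fun s => rep_mx rho (c s)) l.
- by rewrite Zc.2 rep_mul rep_nat.
- by move=> s /cl ->; rewrite Z1_gal_id // rep_one.
exists g; split; first by split.
have [s|w wgv] := @galois_fixed_mx _ _ _ hks n 1 (g *m v); last by exists w, v.
have sg : map_mx s g = g *m rep_mx rho (c s) by rewrite cg mulKVmx.
by rewrite [map_mx s _]map_mxM /= sg -mulmxA cv.
Qed.

Lemma H1_trivial_twisted_point : H1_trivial i G ->
  (exists c, Z1 c /\ exists v, twisted_point c v) <->
  exists w : 'cV[k]_n, fiber f (w : 'cV[kAlg_base k]_n).
Proof.
move=> H1; rewrite -twisted_point1; split=> [[c [Zc [v cv]]]|[v v1]].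
  have [h ch] := H1 c Zc; exists (rep_mx rho h *m v).
  apply/twisted_point_translate; move: cv; congr (twisted_point _ v).
  by apply/funext => s; rewrite ch mulg1.
by exists (fun=> 1); split; [exact: Z1_one | exists v].
Qed.

End TwistedPoints.

Section ObstructionClass.

Local Open Scope group_scope.

Variables (k ks : fieldType) (i : {rmorphism k -> ks}).
Variables (G : groupFunctor k) (n : nat) (rho : representation G n).
Variables (f : quotient_point rho) (D : stabilizer_descent i f).
Implicit Types (v : 'cV[ks]_n) (s t : galAut i).
Implicit Types (c g : galAut i -> G (kAlg_sep i)) (b : D (kAlg_sep i)).
Implicit Types (d : galAut i -> galAut i -> D (kAlg_sep i)).

Section Stabilizer.

Variables (v : 'cV[ks]_n) (fv : fiber f (v : 'cV[kAlg_sep i]_n)).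

Lemma iotaM : {morph iota D v : x y / x * y}.
Proof. exact: iota_mul. Qed.

Lemma iota1 : iota D v 1 = 1.
Proof. by apply: (mulgI (iota D v 1)); rewrite -iotaM !mulg1. Qed.

Lemma iotaV : {morph iota D v : x / x^-1}.
Proof. by move=> x; apply/esym/mulg1_eq; rewrite -iotaM mulgV iota1. Qed.

Lemma iota_semilinear s (h : G (kAlg_sep i)) b :
  rep_mx rho h *m map_mx s v = v ->
  h * gal_act s (iota D v b) = iota D v (gal_act s b) * h.
Proof.
move=> hv; rewrite iota_gal //; set b' := gal_act s b.
have : iota D (rep_mx rho h *m map_mx s v) b' = h * iota D (map_mx s v) b' / h.
  exact: iota_conj (fiber_map s fv) h b'.
by rewrite hv => ->; rewrite mulgVK.
Qed.

End Stabilizer.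

Lemma cobound_iota_mul v g (e : galAut i -> D (kAlg_sep i)) b s t :
  twisted_point f g v -> iota D v b = cobound g s t ->
  cobound (fun r => iota D v (e r) * g r) s t = iota D v (b * cobound e s t).
Proof.
move=> [fv gv] bE; rewrite coboundE gal_actM invgM.
have -> : iota D v (e s) * g s
      * (gal_act s (iota D v (e t)) * gal_act s (g t))
      * ((g (gal_mul s t))^-1 * (iota D v (e (gal_mul s t)))^-1) =
    iota D v (e s) * iota D v (gal_act s (e t)) * cobound g s t
    / iota D v (e (gal_mul s t)).
  rewrite coboundE !mulgA; congr (_ * _ * _ * _).
  by rewrite -!mulgA; congr (_ * _); exact: iota_semilinear.
rewrite -bE -!iotaM // -iotaV // -iotaM //; congr (iota D v _).
by rewrite [cobound e s t]coboundE [RHS]mulgA; congr (_ / _); exact: Gf_comm.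
Qed.

Lemma df_cocycleP v g d : df_cocycle v g d <->
  [/\ continuous1 g, twisted_point f g v &
      forall s t, iota D v (d s t) = cobound g s t].
Proof. by split=> [[fv cg gv dE]|[cg [fv gv] dE]]; split. Qed.

Lemma Z1_of_df_cocycle v g d : df_cocycle v g d ->
  cohomologous2 d (fun _ _ => pone D _) ->
  exists c, Z1 c /\ twisted_point f c v.
Proof.
move=> /df_cocycleP[cg gv dE] [e [ce de]]; have [fv fixv] := gv.
exists (fun s => iota D v (e s) * g s); split.
  apply/Z1_cobound; split=> [|s t].
    exact: (continuous1_op (fun b x => iota D v b * x)).
  by rewrite (cobound_iota_mul e gv (dE s t)) -pmulE -de iota1.
split=> // s; rewrite rep_mul -mulmxA fixv.
by apply/(iota_img D fv); exists (e s).
Qed.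

(* Writing v' = h v, the cochains g' and c differ by h and by values in the
   stabilizer of v. *)
Lemma df_cocycle_coboundary v c v' g d :
  algebraic_group G -> transitive_on_fiber i f -> Z1 c -> twisted_point f c v ->
  df_cocycle v' g d -> cohomologous2 (fun _ _ => pone D _) d.
Proof.
move=> algG trans /Z1_cobound[cc c1] cv /df_cocycleP[cg gv' dE].
have fv := cv.1; have [h hv] := trans.2 _ _ fv gv'.1.
rewrite -{v'}hv in gv' dE.
pose g' s := h^-1 * g s * gal_act s h.
have g'v : twisted_point f g' v by apply/twisted_point_translate.
have cg' : continuous1 g'.
  apply: (continuous1_op (fun x y => h^-1 * x * y)) => //.
  exact: continuous1_gal_act.
have fixv s : fixes rho v (g' s / c s).
  rewrite /fixes -[in LHS](cv.2 s) mulmxA -rep_mul pmulE mulgVK; exact: g'v.2.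
have [e eE] := choice (fun s => (iota_img D fv _).1 (fixv s)).
exists e; split=> [|s t].
  apply: (continuous1_inj (iota_inj fv)).
  have -> : iota D v \o e = fun s => g' s / c s by exact/funext.
  exact: (continuous1_op (fun x y => x / y)).
apply: (iota_inj fv); rewrite -(cobound_iota_mul e cv) ?iota1 ?c1 //.
have -> : (fun s => iota D v (e s) * c s) = g'.
  by apply/funext => r; rewrite eE mulgVK.
rewrite cobound_conjg -dE iota_conj //.
by rewrite !pmulE pinvE conjgE !mulgA mulVg mul1g mulgVK.
Qed.

Lemma df_zero_twisted_point : algebraic_group G -> transitive_on_fiber i f ->
  df D = H2_zero i D <-> exists c, Z1 c /\ exists v, twisted_point f c v.
Proof.
move=> algG trans; split=> [df0|[c [Zc [v cv]]]].
  have : H2_zero i D (fun _ _ => pone D _).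
    by split; [exact: Z2_one | exact: cohomologous2_refl].
  rewrite -df0 => -[v [g [d [dvg [_ d1]]]]].
  have [c [Zc cv]] := Z1_of_df_cocycle dvg d1.
  by exists c; split=> //; exists v.
apply/funext => d'; apply/propext; split=> [[v' [g [d [dvg [Zd' dd']]]]]|d'0].
  split=> //; apply: cohomologous2_trans dd'; first exact: Gf_comm.
  exact: df_cocycle_coboundary cv dvg.
have [cc c1] := (Z1_cobound c).1 Zc; exists v, c, (fun _ _ => pone D _).
by split=> //; apply/df_cocycleP; split=> // s t; rewrite c1 iota1 //; case: cv.
Qed.

End ObstructionClass.

Unset Implicit Arguments.

Theorem theorem2p3 (k ks : fieldType) (i : {rmorphism k -> ks})
  (hks : is_separable_closure i)
  (G : groupFunctor k) (hG : reductive G)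
  (n : nat) (rho : representation G n) (f : quotient_point rho)
  (htrans : transitive_on_fiber i f) (hab : abelian_stabilizers i f)
  (D : stabilizer_descent i f) :
  (df D = H2_zero i D <->
     exists c : galAut i -> G (kAlg_sep i), Z1 c /\
       exists g : 'M[ks]_n, trivializes rho g c /\
         exists w : 'cV[k]_n, twisted_fiber i f g w) /\
  (H1_trivial i G ->
     (df D = H2_zero i D <->
        exists v : 'cV[k]_n, fiber f (v : 'cV[kAlg_base k]_n))).
Proof.
have algG : algebraic_group G by case: hG.
rewrite df_zero_twisted_point //; split; last exact: H1_trivial_twisted_point.
by split=> -[c [Zc cv]]; exists c; split=> //;
  apply/(twisted_point_trivialize _ hks Zc).
Qed.
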